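(* Assume that the field of scalars is $\mathbb{R}$ or $\mathbb{C}$. Let $X$ be a Banach lattice that contains an infinite-dimensional subspace doing stable phase retrieval. Then the closed linear span of the atoms of $X$ has infinite codimension in $X$.
   Context: An atom of a Banach lattice $X$ is a non-zero positive element $x_0\in X$ such that whenever $0\leq x\leq x_0$, it follows that $x=\lambda x_0$ for some scalar $\lambda\ge 0$. A linear subspace $E$ of a (real or complex) Banach lattice $X$ does $C$-stable phase retrieval ($C$-SPR) if $\min_{|\lambda|=1}\|x-\lambda y\|\leq C\,\||x|-|y|\|$ for all $x,y\in E$ (the minimum being over unimodular scalars $\lambda$); it does stable phase retrieval (SPR) if it does $C$-SPR for some constant $C\geq1$. *)

(* Defs.v *)
From HB Require Import structures.
From mathcomp Require Import all_boot all_order all_algebra.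
From mathcomp Require Import complex.
From mathcomp Require Import all_classical all_reals all_analysis.
Set Implicit Arguments.
Unset Strict Implicit.
Unset Printing Implicit Defensive.
Import Order.TTheory GRing.Theory Num.Theory.
Import numFieldNormedType.Exports.
Local Open Scope classical_set_scope.
Local Open Scope ring_scope.

(* The order is a field of the mixin because Hierarchy-Builder rejects a join
   of NormedModule with Order.POrder (it would compete with Num.NumDomain as a
   join of the preorder and norm structures).  It is made the canonical order of the carrier right below. *)
HB.mixin Record isBanachLattice (R : realType) X
    & CompleteNormedModule R X := {
  lev : rel X;
  meetv : X -> X -> X;
  joinv : X -> X -> X;
  lev_refl : reflexive lev;
  lev_anti : antisymmetric lev;
  lev_trans : transitive lev;
  meetvP : forall x y z, lev x (meetv y z) = lev x y && lev x z;
  joinvP : forall x y z, lev (joinv x y) z = lev x z && lev y z;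
  levD2r : forall z x y, lev x y -> lev (x + z) (y + z);
  scalev_ge0 : forall (a : R) x, 0 <= a -> lev 0 x -> lev 0 (a *: x);
  lev_norm : forall x y, lev (joinv x (- x)) (joinv y (- y)) -> `|x| <= `|y|
}.

#[short(type="banachLatticeType")]
HB.structure Definition BanachLattice (R : realType) :=
  {X of CompleteNormedModule R X & isBanachLattice R X}.

Section BanachLatticeOrder.
Variables (R : realType) (X : banachLatticeType R).

#[non_forgetful_inheritance]
HB.instance Definition _ := Order.Le_isPOrder.Build ring_display
  (BanachLattice.sort X) (@lev_refl R X) (@lev_anti R X) (@lev_trans R X).
#[non_forgetful_inheritance]
HB.instance Definition _ := Order.POrder_MeetJoin_isLattice.Build ring_display
  (BanachLattice.sort X) (@meetvP R X) (@joinvP R X).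

End BanachLatticeOrder.

Definition absv (R : realType) (X : banachLatticeType R) (x : X) : X :=
  Order.join x (- x).

Section BanachLatticeTheory.
Variables (R : realType) (X : banachLatticeType R).
Implicit Types (x y z u : X) (A : set X).

Lemma levDr z x y : x <= y -> x + z <= y + z. Proof. exact: levD2r. Qed.

Lemma levD x y z t : x <= y -> z <= t -> x + z <= y + t.
Proof.
move=> xy zt; apply: le_trans (levDr z xy) _.
by rewrite ![y + _]addrC; exact: levDr.
Qed.

Lemma subv_ge0 x y : (0 <= y - x) = (x <= y).
Proof.
apply/idP/idP => [/(levDr x)|/(levDr (- x))]; first by rewrite add0r subrK.
by rewrite subrr.
Qed.

Lemma scalev_homo (a : R) x y : 0 <= a -> x <= y -> a *: x <= a *: y.
Proof.
rewrite -(subv_ge0 x y) -(subv_ge0 (a *: x)) -scalerBr.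
exact: scalev_ge0.
Qed.

Lemma le_absv x : x <= absv x. Proof. exact: leUl. Qed.

Lemma leN_absv x : - x <= absv x. Proof. exact: leUr. Qed.

Lemma absv_le x u : x <= u -> - x <= u -> absv x <= u.
Proof. by move=> xu Nxu; rewrite /absv leUx xu. Qed.

Lemma pos_of_pm x u : x <= u -> - x <= u -> 0 <= u.
Proof.
move=> xu Nxu; have := levD xu Nxu; rewrite subrr -mulr2n -scaler_nat => u0.
have : 0 <= 2^-1 *: (2%:R *: u) by apply: scalev_ge0.
by rewrite scalerA mulVf ?pnatr_eq0// scale1r.
Qed.

Lemma absv_ge0 x : 0 <= absv x.
Proof. exact: pos_of_pm (le_absv x) (leN_absv x). Qed.

Lemma absv_id x : 0 <= x -> absv x = x.
Proof.
move=> x0; apply/le_anti; rewrite le_absv andbT; apply: absv_le => //.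
by have := levDr (- x) x0; rewrite add0r subrr => /le_trans; apply.
Qed.

Lemma norm_absv_homo x y : absv x <= absv y -> `|x| <= `|y|.
Proof. exact: lev_norm. Qed.

Lemma norm_absv x : `|absv x| = `|x|.
Proof.
apply/le_anti/andP; split; apply: norm_absv_homo; by rewrite (absv_id (absv_ge0 x)).
Qed.

Lemma norm_le_pm x u : x <= u -> - x <= u -> `|x| <= `|u|.
Proof.
move=> xu Nxu; apply: norm_absv_homo; by rewrite (absv_id (pos_of_pm xu Nxu)); exact: absv_le.
Qed.

Lemma norm_homo x y : 0 <= x -> x <= y -> `|x| <= `|y|.
Proof.
move=> x0 xy; apply: norm_le_pm => //; apply: le_trans (le_trans x0 xy).
by have := levDr (- x) x0; rewrite add0r subrr.
Qed.

Lemma le_approx x y :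
  (forall e : R, 0 < e -> exists2 w : X, x <= y + w & `|w| <= e) -> x <= y.
Proof.
move=> H; rewrite -subv_ge0 -opprB.
set d := x - y; have p0 : 0 <= Order.join d 0 by exact: leUr.
suff : `|Order.join d 0| <= 0.
  rewrite normr_le0 => /eqP pe; have : d <= Order.join d 0 by exact: leUl.
  by rewrite pe -subv_ge0 sub0r.
apply/ler_addgt0Pr => e e0; rewrite add0r.
have [w xyw we] := H _ e0; apply: le_trans we; rewrite -(norm_absv w).
apply: norm_homo => //; rewrite leUx absv_ge0 andbT.
apply: le_trans (le_absv w); have := levDr (- y) xyw.
by rewrite [y + w]addrC addrK.
Qed.

(* Banach lattices need not be order complete; this is the case in which the
   supremum exists because A has finite sups approximating it uniformly. *)
Lemma approx_has_sup A u : 0 <= u ->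
  (forall e : R, 0 < e -> exists t : X, (forall a, A a -> a <= t + e *: u) /\
     (forall v, ubound A v -> t <= v + e *: u)) ->
  supremums A !=set0.
Proof.
move=> u0 H.
have /choice[t Ht] : forall n : nat, exists t : X,
    (forall a, A a -> a <= t + n.+1%:R^-1 *: u) /\
    (forall v, ubound A v -> t <= v + (n.+1%:R^-1 : R) *: u).
  by move=> n; apply: H; rewrite invr_gt0.
have tle n m : t n <= t m + (m.+1%:R^-1 + n.+1%:R^-1 : R) *: u.
  rewrite scalerDl addrA; apply: (Ht n).2 => a; exact: (Ht m).1.
have tB n m : `|t n - t m| <= (m.+1%:R^-1 + n.+1%:R^-1) * `|u|.
  rewrite -[X in X * _]ger0_norm ?addr_ge0 ?invr_ge0// -normrZ.
  apply: norm_le_pm.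
    by have := levDr (- t m) (tle n m); rewrite [t m + _]addrC addrK.
  rewrite opprB; have := levDr (- t n) (tle m n).
  by rewrite [t n + _]addrC addrK [m.+1%:R^-1 + _]addrC.
have small (e : R) : 0 < e -> \forall n \near \oo, n.+1%:R^-1 * `|u| <= e.
  move=> e0; have : (fun n : nat => n.+1%:R^-1 * `|u|) @ \oo --> (0 : R).
    rewrite -[X in _ --> X](mul0r `|u|); apply: cvgMl => //.
    exact: cvg_harmonic.
  move/cvgrPdist_le => /(_ e e0); apply: filterS => n; rewrite sub0r normrN.
  by rewrite ger0_norm// mulr_ge0// invr_ge0.
have /cvg_ex[s ts] : cvgn t.
  apply: cauchy_cvg; apply/cauchy_ballP => e e0.
  have e20 : 0 < e / 4 by rewrite divr_gt0.
  have sm := small _ e20.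
  exists (t @` [set n | n.+1%:R^-1 * `|u| <= e / 4],
          t @` [set n | n.+1%:R^-1 * `|u| <= e / 4]).
    by split => /=; apply: filterS sm => n Hn; exists n.
  move=> [_ _] [[n /= Hn <-] [m /= Hm <-]]; rewrite -ball_normE /=.
  apply: le_lt_trans (tB n m) _; rewrite mulrDl.
  apply: le_lt_trans (lerD Hm Hn) _; rewrite -mulrDl ltr_pdivrMr//.
  by rewrite -mulr2n -[ltLHS]mulr_natr ltr_pM2l// ltr_nat.
have near_ts (e : R) : 0 < e ->
    exists n, `|s - t n| <= e / 2 /\ n.+1%:R^-1 * `|u| <= e / 2.
  move=> e0; have e20 : 0 < e / 2 by rewrite divr_gt0.
  move/cvgrPdist_le : ts => /(_ _ e20) ts.
  have [n [? ?]] := filter_ex (filterI ts (small _ e20)); by exists n.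
exists s; split => [a Aa|v Av]; apply: le_approx => e /near_ts[n [H1 H2]].
  exists (t n - s + n.+1%:R^-1 *: u).
    by rewrite addrA [s + _]addrC subrK; exact: (Ht n).1.
  apply: le_trans (ler_normD _ _) _; rewrite [e]splitr distrC lerD//.
  by rewrite normrZ ger0_norm// invr_ge0.
exists (n.+1%:R^-1 *: u + (s - t n)).
  rewrite addrA -[leLHS](subrK (t n)) [leLHS]addrC.
  by apply: levDr; exact: (Ht n).2.
apply: le_trans (ler_normD _ _) _; rewrite [e]splitr addrC lerD//.
by rewrite normrZ ger0_norm// invr_ge0.
Qed.

Lemma scalev_le_norm (a e : R) x : `|a| <= e -> a *: x <= e *: absv x.
Proof.
move=> ae; apply: (@le_trans _ _ (`|a| *: absv x)); last first.
  rewrite -(subv_ge0 (`|a| *: _)) -scalerBl; apply: scalev_ge0.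
    by rewrite subr_ge0.
  exact: absv_ge0.
have [a0|a0] := leP 0 a; last first.
  have -> : a *: x = `|a| *: - x by rewrite ltr0_norm// scalerN scaleNr opprK.
  by apply: scalev_homo => //; exact: leN_absv.
by rewrite ger0_norm//; apply: scalev_homo => //; exact: le_absv.
Qed.

Lemma rotation_has_sup x y :
  supremums (range (fun t : R => cos t *: x + sin t *: y)) !=set0.
Proof.
set f := fun t : R => _; pose u := absv x + absv y.
have u0 : 0 <= u.
  by rewrite -[0]addr0; apply: levD; exact: absv_ge0.
apply: (approx_has_sup u0) => e e0.
pose N := (Num.truncn e^-1).+1.
have N0 : 0 < N%:R :> R by rewrite ltr0n.
have Ne : N%:R^-1 <= e.
  rewrite -[leRHS]invrK lef_pV2 ?posrE ?invr_gt0//.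
  by rewrite ltW// truncnS_gt.
pose c (i : nat) : R := i%:R / N%:R - 1.
have gridP (a : R) : `|a| <= 1 ->
    exists2 i, (i < (N * 2).+1)%N & `|a - c i| <= e.
  rewrite ler_norml => /andP[aN1 a1].
  have a0 : 0 <= (a + 1) * N%:R.
    by apply: mulr_ge0; rewrite ?ler0n// -lerBlDr sub0r.
  have /andP[] := truncn_itv a0; move: (Num.truncn _) => k tr1 tr2.
  exists k.
    rewrite ltnS -(ler_nat R); apply: le_trans tr1 _.
    by rewrite natrM mulrC ler_pM2l//; exact: (lerD a1 (lexx 1)).
  apply: le_trans Ne; rewrite /c opprB addrA -[a + 1](mulfK (lt0r_neq0 N0)).
  rewrite -mulrBl normrM [`|_^-1|]gtr0_norm ?invr_gt0//.
  rewrite -[leRHS]mul1r ler_pM2r ?invr_gt0// ger0_norm ?subr_ge0//.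
  by rewrite lerBlDl natr1 ltW.
have close (a b a' b' : R) : `|a - a'| <= e -> `|b - b'| <= e ->
    a *: x + b *: y <= a' *: x + b' *: y + e *: u.
  move=> /(scalev_le_norm x) xe /(scalev_le_norm y) ye.
  have := levDr (a' *: x + b' *: y) (levD xe ye).
  rewrite -scalerDr -/u [leRHS]addrC.
  by rewrite addrACA -!scalerDl !subrK.
pose L := [seq c p.1 *: x + c p.2 *: y | p <-
  [seq p <- allpairs pair (iota 0 (N * 2).+1) (iota 0 (N * 2).+1) |
     `[< exists t, `|cos t - c p.1| <= e /\ `|sin t - c p.2| <= e >] ]].
have Lup a : range f a -> exists2 b, b \in L & a <= b + e *: u.
  move=> [t _ <-].
  have [|i iN ci] := gridP (cos t).
    by rewrite ler_norml cos_geN1 cos_le1.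
  have [|j jN cj] := gridP (sin t).
    by rewrite ler_norml sin_geN1 sin_le1.
  exists (c i *: x + c j *: y); last exact: close.
  apply/mapP; exists (i, j) => //; rewrite mem_filter; apply/andP; split.
    by apply/asboolP; exists t.
  by apply/allpairsP; exists (i, j); rewrite !mem_iota.
have Llow b : b \in L -> exists2 a, range f a & b <= a + e *: u.
  move=> /mapP[[i j]]; rewrite mem_filter => /andP[/asboolP[t [ci cj]] _] ->.
  by exists (f t); [exists t|apply: close; rewrite distrC].
have joinL (s : seq X) : s != [::] ->
    exists t : X, forall z : X, (t <= z) = all (fun b => b <= z) s.
  elim: s => // b [_ _|b' s IH _]; first by exists b => z /=; rewrite andbT.
  have [//|t tP] := IH; exists (Order.join b t) => z.
  by rewrite leUx tP.
have [|t tP] := joinL L.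
  by have [b] := Lup (f 0) (ex_intro2 _ _ 0 I erefl); case: (L).
exists t; split => [a /Lup[b bL ab]|v vA].
  apply: le_trans ab _; apply: levDr.
  have := lexx t; rewrite {1}tP => /allP; exact.
rewrite tP; apply/allP => b /Llow[a /vA av]; move/le_trans; apply.
exact: levDr.
Qed.

End BanachLatticeTheory.

Section Atoms.
Variables (R : realType) (X : banachLatticeType R).

Definition atom (x0 : X) :=
  [/\ x0 <> 0, 0 <= x0 & forall x : X, 0 <= x -> x <= x0 ->
     exists2 l : R, 0 <= l & x = l *: x0].

End Atoms.

(* The complexification X_C = X + iX of a real Banach lattice X; (x, y) stands
   for x + iy.  This is what a complex Banach lattice is. *)
Definition complexification (R : realType) (X : banachLatticeType R) : Type :=
  (X * X)%type.

Section Complexification.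
Variables (R : realType) (X : banachLatticeType R).
Notation XC := (complexification X).
Implicit Types (z w : XC) (a b : R[i]).

HB.instance Definition _ := GRing.Zmodule.copy XC (X * X)%type.

Definition scalec a z : XC :=
  (complex.Re a *: z.1 - complex.Im a *: z.2, complex.Re a *: z.2 + complex.Im a *: z.1).

Let scalecA a b z : scalec a (scalec b z) = scalec (a * b) z.
Proof.
case: a b z => [a a'] [b b'] [x y]; rewrite /scalec /=; congr pair;
  rewrite !scalerBr !scalerDr !scalerBl !scalerDl !scalerA;
  by rewrite ?opprD !addrA addrAC; congr (_ + _); rewrite addrAC.
Qed.

Let scale1c : left_id 1 scalec.
Proof. by case=> x y; rewrite /scalec /= !scale1r !scale0r subr0 addr0. Qed.

Let scalecDr : right_distributive scalec +%R.
Proof.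
move=> [a a'] [x y] [z w]; rewrite /scalec /=; congr pair.
  by rewrite !scalerDr opprD addrACA.
by rewrite !scalerDr addrACA.
Qed.

Let scalecDl z : {morph scalec^~ z : a b / a + b}.
Proof.
move=> [a a'] [b b']; case: z => x y; rewrite /scalec /=; congr pair.
  by rewrite !scalerDl opprD addrACA.
by rewrite !scalerDl addrACA.
Qed.

HB.instance Definition _ := GRing.Zmodule_isLmodule.Build R[i] XC
  scalecA scale1c scalecDr scalecDl.

(* |x + iy| = sup_t (cos t x + sin t y) in X; the default value of supremum is
   never used, by modc_supremums. *)
Definition modc z : X :=
  supremum 0 (range (fun t : R => cos t *: z.1 + sin t *: z.2)).

Definition cplx_of_real (x : X) : XC := (x, 0).

Lemma modc_supremums z :
  supremums (range (fun t : R => cos t *: z.1 + sin t *: z.2)) (modc z).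
Proof.
rewrite /modc /supremum; case: ifPn => [/eqP A0|_].
  by have : set0 (cos 0 *: z.1 + sin 0 *: z.2) by rewrite -A0; exists 0.
by apply: xgetPex; exact: rotation_has_sup.
Qed.

Lemma modc_ub z (t : R) : cos t *: z.1 + sin t *: z.2 <= modc z.
Proof. by apply: (modc_supremums z).1; exists t. Qed.

Lemma modc_lub z (m : X) :
  (forall t : R, cos t *: z.1 + sin t *: z.2 <= m) -> modc z <= m.
Proof. by move=> H; apply: (modc_supremums z).2 => _ [t _ <-]. Qed.

Lemma modc_pm z : [/\ z.1 <= modc z, - z.1 <= modc z,
  z.2 <= modc z & - z.2 <= modc z].
Proof.
split.
- by have := modc_ub z 0; rewrite cos0 sin0 scale1r scale0r addr0.
- by have := modc_ub z pi; rewrite cospi sinpi scaleN1r scale0r addr0.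
- have := modc_ub z (pi / 2).
  by rewrite cos_pihalf sin_pihalf scale1r scale0r add0r.
- have := modc_ub z (- (pi / 2)).
  by rewrite cosN sinN cos_pihalf sin_pihalf scaleN1r scale0r add0r.
Qed.

Lemma modc_ge0 z : 0 <= modc z.
Proof. by have [+ + _ _] := modc_pm z; exact: pos_of_pm. Qed.

(* The norm of the complexification is || |z| ||, as an element of R[i]. *)
Definition normXC z : R[i] := (`|modc z|)%:C%C.

Let normXCD z w : normXC (z + w) <= normXC z + normXC w.
Proof.
rewrite /normXC -rmorphD lecR; apply: le_trans (ler_normD _ _).
apply: norm_homo; first exact: modc_ge0.
apply: modc_lub => t /=; rewrite !scalerDr addrACA.
by apply: levD; exact: modc_ub.
Qed.

Let polar a : exists (r t : R),
  [/\ `|a| = r%:C%C, 0 <= r, complex.Re a = r * cos t & complex.Im a = r * sin t].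
Proof.
rewrite normc_def; set r := Num.sqrt _.
have r0 : 0 <= r by exact: sqrtr_ge0.
have rE : r ^+ 2 = complex.Re a ^+ 2 + complex.Im a ^+ 2.
  by rewrite sqr_sqrtr// addr_ge0 ?sqr_ge0.
exists r; have [r_eq0|r_neq0] := eqVneq r 0.
  exists 0; rewrite r_eq0 !mul0r lexx.
  have /eqP := rE; rewrite r_eq0 expr0n/= eq_sym paddr_eq0 ?sqr_ge0//.
  by rewrite !sqrf_eq0 => /andP[/eqP-> /eqP->].
have rgt0 : 0 < r by rewrite lt_neqAle eq_sym r_neq0.
pose c := complex.Re a / r; pose s := complex.Im a / r.
have cs : c ^+ 2 + s ^+ 2 = 1.
  by rewrite !expr_div_n -mulrDl -rE divff// sqrf_eq0.
have cI : -1 <= c <= 1.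
  by rewrite -ler_norml -(@expr_le1 _ 2)// real_normK ?num_real// -cs lerDl sqr_ge0.
have sE : 1 - c ^+ 2 = s ^+ 2 by rewrite -cs addrAC subrr add0r.
have Re_c : complex.Re a = r * c by rewrite mulrC divfK.
have Im_s : complex.Im a = r * s by rewrite mulrC divfK.
have [s0|s0] := leP 0 s.
  exists (acos c); split => //; first by rewrite acosK// in_itv.
  by rewrite sin_acos// sE sqrtr_sqr ger0_norm.
exists (- acos c); split => //; first by rewrite cosN acosK// in_itv.
by rewrite sinN sin_acos// sE sqrtr_sqr ltr0_norm// opprK.
Qed.

Let normXCZ_le a z : normXC (a *: z) <= `|a| * normXC z.
Proof.
have [r [t [-> r0 Rea Ima]]] := polar a.
rewrite /normXC -rmorphM lecR -[X in X * _](ger0_norm r0) -normrZ.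
apply: norm_homo; first exact: modc_ge0.
apply: modc_lub => t'.
have -> : cos t' *: (a *: z).1 + sin t' *: (a *: z).2 =
    r *: (cos (t' - t) *: z.1 + sin (t' - t) *: z.2).
  rewrite /= Rea Ima cosB sinB !scalerDr !scalerN !scalerA.
  rewrite !(mulrCA _ r) mulrDr mulrBr scalerDl scalerBl.
  by rewrite [X in _ + X = _]addrC addrACA [X in _ + X = _]addrC.
by apply: scalev_homo => //; exact: modc_ub.
Qed.

Let normXCZ a z : normXC (a *: z) = `|a| * normXC z.
Proof.
have normXC_ge0 w : 0 <= normXC w by rewrite /normXC ler0c.
apply/le_anti; rewrite normXCZ_le/=; have [->|a0] := eqVneq a 0.
  by rewrite normr0 mul0r.
rewrite -ler_pdivlMl ?normr_gt0// -normfV.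
apply: le_trans (normXCZ_le _ _).
by rewrite scalerA mulVf// scale1r.
Qed.

Let normXC0_eq0 z : normXC z = 0 -> z = 0.
Proof.
move=> /complexI/normr0_eq0 z0; have := modc_pm z; rewrite z0.
have eq0 (x : X) : x <= 0 -> - x <= 0 -> x = 0.
  move=> x0 Nx0; apply/le_anti; rewrite x0/=.
  by have := levDr x Nx0; rewrite addNr add0r.
by case: z {z0} => x y /= [? ? ? ?]; congr pair; exact: eq0.
Qed.

HB.instance Definition _ :=
  Lmodule_isNormed.Build R[i] XC normXCD normXCZ normXC0_eq0.

(* The positive cone of X_C is that of X, hence so are the atoms. *)
Definition atomc : set XC := cplx_of_real @` @atom R X.

Lemma modc_real (x : X) : modc (cplx_of_real x) = absv x.
Proof.
apply/le_anti/andP; split.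
  apply: modc_lub => t /=; rewrite scaler0 addr0 -[leRHS]scale1r.
  by apply: scalev_le_norm; rewrite ler_norml cos_geN1 cos_le1.
have [xm Nxm _ _] := modc_pm (cplx_of_real x); exact: absv_le.
Qed.

Lemma norm_cplx_of_real (x : X) : `|cplx_of_real x| = (`|x|)%:C%C.
Proof.
by change (normXC (cplx_of_real x) = (`|x|)%:C%C);
  rewrite /normXC modc_real norm_absv.
Qed.

Definition absc z : XC := cplx_of_real (modc z).

End Complexification.

Section Subspaces.
Variables (K : numFieldType) (V : lmodType K).
Implicit Types (E F S : set V).

Definition linear_subspace E :=
  E 0 /\ forall (a : K) x y, E x -> E y -> E (a *: x + y).

Definition lin_span S : set V :=
  [set v | exists n (a : 'I_n -> K) (x : 'I_n -> V),
     (forall i, S (x i)) /\ v = \sum_(i < n) a i *: x i].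

Definition finite_dimensional E :=
  exists s : seq V, E = lin_span [set` s].

(* The classes of the elements of s span the quotient V / F. *)
Definition finite_codimension F :=
  exists s : seq V, forall v, exists2 w, lin_span [set` s] w & F (v - w).

End Subspaces.

Section PhaseRetrieval.
Variables (K : numFieldType) (V : normedModType K).
Implicit Types (modulus : V -> V) (C : K) (E : set V).

(* The set of unimodular scalars is compact, so that the minimum over it is at
   most c exactly when some unimodular scalar gives a value at most c.  For
   K = R[i], an inequality in K whose one side is real forces the other side to
   be real, so C is in effect a real constant once 1 <= C. *)
Definition C_SPR modulus C E := forall x y, E x -> E y ->
  exists2 l : K, `|l| = 1 & `|x - l *: y| <= C * `|modulus x - modulus y|.

Definition SPR modulus E := exists2 C : K, 1 <= C & C_SPR modulus C E.

End PhaseRetrieval.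

(* Main.v *)
Require Import Defs.
From mathcomp Require Import all_boot all_order all_algebra.
From mathcomp Require Import complex ring.
From mathcomp Require Import all_classical all_reals all_analysis.
(* If the closed span of the atoms had finite codimension, it would contain some
   x <> 0 of E, and x is close to a finite combination w of atoms e_i.  The
   disjoint complement of an atom has codimension at most one, so E contains some
   y with |y| = |x| (norms) that is disjoint from all the e_i, hence from w.
   Disjointness gives |w + y| = |w - y| for the moduli, so x + y and x - y have
   almost equal moduli, whereas x + y - l (x - y) = (1 - l) x + (1 + l) y stays
   far from 0 for every unimodular l, because 2 <= |1 - l| + |1 + l|. *)

Set Implicit Arguments.
Unset Strict Implicit.
Unset Printing Implicit Defensive.
Import Order.TTheory GRing.Theory Num.Theory.
Import numFieldNormedType.Exports.
Local Open Scope classical_set_scope.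
Local Open Scope ring_scope.

(** * Linear algebra: independent families, kernels, finite codimension *)

Section LinearAlgebra.
Variables (K : numFieldType) (V : lmodType K).
Implicit Types (E F S : set V) (a : K) (x y v : V).

Lemma linear_subspace_sum E n (a : 'I_n -> K) (x : 'I_n -> V) :
  linear_subspace E -> (forall i, E (x i)) -> E (\sum_(i < n) a i *: x i).
Proof.
move=> [E0 EL] Ex; elim: n a x Ex => [|n IH] a x Ex; first by rewrite big_ord0.
by rewrite big_ord_recl; apply: EL => //; apply: IH.
Qed.

Lemma linear_subspaceZ E a x : linear_subspace E -> E x -> E (a *: x).
Proof. by move=> [E0 EL] Ex; rewrite -[_ *: _]addr0; exact: EL. Qed.

Lemma linear_subspaceD E x y : linear_subspace E -> E x -> E y -> E (x + y).
Proof. by move=> [E0 EL] Ex Ey; rewrite -[x]scale1r; exact: EL. Qed.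

Lemma linear_subspaceB E x y : linear_subspace E -> E x -> E y -> E (x - y).
Proof.
move=> lE Ex Ey; apply: linear_subspaceD => //; rewrite -scaleN1r.
exact: linear_subspaceZ.
Qed.

Lemma lin_span_linear S : linear_subspace (lin_span S).
Proof.
split=> [|a _ _ [n [b [x [Sx ->]]]] [m [c [y [Sy ->]]]]].
  by exists 0%N, (fun=> 0), (fun=> 0); split=> [[]//|]; rewrite big_ord0.
exists (n + m)%N,
  (fun i => match fintype.split i with inl i => a * b i | inr j => c j end),
  (fun i => match fintype.split i with inl i => x i | inr j => y j end).
split=> [i|]; first by case: (fintype.split i).
rewrite big_split_ord scaler_sumr; congr (_ + _); apply: eq_bigr => i _.
  by rewrite (unsplitK (inl i)) scalerA.
by rewrite (unsplitK (inr i)).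
Qed.

(** Combinations indexed by the positions of [s] form a subspace that contains every element of [s],
    so a family of any length reduces to a coefficient row of fixed length. *)
Lemma lin_span_seq (s : seq V) v : lin_span [set` s] v ->
  exists r : 'rV[K]_(size s), v = \sum_i r 0 i *: s`_i.
Proof.
move=> [n [a [x [sx ->]]]].
pose L v := exists r : 'rV[K]_(size s), v = \sum_i r 0 i *: s`_i.
apply: (@linear_subspace_sum L) => [|i].
  split=> [|b _ _ [r ->] [t ->]].
    by exists 0; rewrite big1// => i _; rewrite mxE scale0r.
  exists (b *: r + t); rewrite scaler_sumr -big_split/=; apply: eq_bigr => i _.
  by rewrite !mxE scalerA -scalerDl.
have si : (index (x i) s < size s)%N by rewrite index_mem; exact: sx.
exists (delta_mx 0 (Ordinal si)); rewrite (bigD1 (Ordinal si))//= mxE !eqxx.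
rewrite scale1r nth_index; last exact: sx.
by rewrite big1 ?addr0// => k ki; rewrite mxE (negPf ki) scale0r.
Qed.

(** Induction on [n]: the vectors found so far cannot span [E], so some [v] in [E] lies outside
    their span, and a relation with non-zero coefficient at [v] would put it back inside. *)
Lemma infinite_dimensional_free E n :
  linear_subspace E -> ~ finite_dimensional E ->
  exists x : 'I_n -> V, (forall i, E (x i)) /\
    forall c : 'I_n -> K, \sum_i c i *: x i = 0 -> forall i, c i = 0.
Proof.
move=> lE Einf; elim: n => [|n [x [Ex xfree]]].
  by exists (fun=> 0); split=> [[]|c _ []].
pose s := [seq x i | i <- enum 'I_n].
have [v Ev sv] : exists2 v, E v & ~ lin_span [set` s] v.
  apply: contrapT => H; apply: Einf; exists s; apply/seteqP; split=> v.
    by move=> Ev; apply: contrapT => sv; apply: H; exists v.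
  move=> [m [a [y [sy ->]]]]; apply: linear_subspace_sum => // i.
  by have /mapP[k _ ->] := sy i.
exists (fun i => if unlift ord0 i is Some j then x j else v).
split=> [i|c]; first by case: unlift.
rewrite big_ord_recl unlift_none; under eq_bigr do rewrite liftK.
move=> c0; have c00 : c ord0 = 0.
  apply: contrapT => /eqP c_neq0; apply: sv.
  have -> : v = \sum_(i < n) (- (c ord0)^-1 * c (lift ord0 i)) *: x i.
    under eq_bigr do rewrite -scalerA.
    rewrite -scaler_sumr; move/eqP : c0; rewrite addrC addr_eq0 => /eqP ->.
    by rewrite scaleNr scalerN opprK scalerA mulVf// scale1r.
  exists n, (fun i => - (c ord0)^-1 * c (lift ord0 i)), x; split => // i.
  by apply: map_f; rewrite mem_enum.
move: c0; rewrite c00 scale0r add0r => /xfree c0 i.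
by case: (unliftP ord0 i) => [j|] ->.
Qed.

(* A linear relation into K^n stands for n linear functionals that need not be
   single-valued: coordinates modulo a subspace are given in this form. *)
Lemma infinite_dimensional_kernel E n (P : V -> 'rV[K]_n -> Prop) :
  linear_subspace E -> ~ finite_dimensional E ->
  (forall x, exists r, P x r) -> P 0 0 ->
  (forall a x y r s, P x r -> P y s -> P (a *: x + y) (a *: r + s)) ->
  exists x, [/\ E x, x <> 0 & P x 0].
Proof.
move=> lE Einf /choice[f Pf] P0 PL.
have [x [Ex xfree]] := infinite_dimensional_free n.+1 lE Einf.
(* More rows than columns: a non-zero row [c] with [c *m A = 0] gives the combination of the
   independent [x i] that is sought. *)
pose A := \matrix_(i < n.+1) f (x i).
have : kermx A != 0.
  by rewrite kermx_eq0 /row_free neq_ltn ltnS rank_leq_col.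
case/rowV0Pn => c /sub_kermxP cA c0.
exists (\sum_i c 0 i *: x i); split; first exact: linear_subspace_sum.
  move=> /xfree ci0; move/eqP : c0; apply; apply/rowP => i.
  by rewrite mxE ci0.
rewrite -cA mulmx_sum_row; under [X in P _ X]eq_bigr do rewrite rowK.
elim/big_ind2 : _ => [//|u r v s ur vs|i _].
  by rewrite -[u]scale1r -[r]scale1r; exact: PL.
by rewrite -[_ *: _]addr0 -[_ *: f _]addr0; exact: PL.
Qed.

(** The coordinates of a vector modulo [F], along elements [s] whose classes span the quotient, form
    a linear relation; coordinates 0 mean membership in [F]. *)
Lemma infinite_dimensional_finite_codimension E F :
  linear_subspace E -> ~ finite_dimensional E ->
  linear_subspace F -> finite_codimension F ->
  exists x, [/\ E x, x <> 0 & F x].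
Proof.
move=> lE Einf lF [s Fs].
have := @infinite_dimensional_kernel E (size s)
  (fun v r => F (v - \sum_i r 0 i *: s`_i)) lE Einf.
case=> [v||a x y r t Fx Fy|x [Ex x0]].
- by have [_ /lin_span_seq[r ->] Fv] := Fs v; exists r.
- by rewrite big1 ?subr0 => [|i _]; [exact: lF.1|rewrite mxE scale0r].
- suff -> : a *: x + y - \sum_i (a *: r + t) 0 i *: s`_i =
     a *: (x - \sum_i r 0 i *: s`_i) + (y - \sum_i t 0 i *: s`_i).
    by apply: lF.2.
  rewrite scalerBr scaler_sumr addrACA -opprD -big_split/=; congr (_ - _).
  by apply: eq_bigr => i _; rewrite !mxE scalerA -scalerDl.
- rewrite big1 ?subr0 => [Fx|i _]; first by exists x.
  by rewrite mxE scale0r.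
Qed.

End LinearAlgebra.

(** * Disjoint elements of a real Banach lattice *)

Section Disjointness.
Variables (R : realType) (X : banachLatticeType R).
Implicit Types (u v w e x y : X).

Lemma addv_ge0 u v : 0 <= u -> 0 <= v -> 0 <= u + v.
Proof. by move=> u0 v0; rewrite -[0]addr0; exact: levD. Qed.

(* scalev_ge0 is stated with the mixin field lev instead of the order of X. *)
Lemma scalev_nneg (a : R) u : 0 <= a -> 0 <= u -> 0 <= a *: u.
Proof. exact: scalev_ge0. Qed.

Lemma lev_subl u v w : (u - v <= w) = (u <= w + v).
Proof. by rewrite -[LHS]subv_ge0 -[RHS]subv_ge0 opprB addrA. Qed.

(** Each meet on the right is isolated in turn by subtraction, and is then tested against its two
    arguments. *)
Lemma meet_addv_le u v w : 0 <= u -> 0 <= v -> 0 <= w ->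
  Order.meet (u + v) w <= Order.meet u w + Order.meet v w.
Proof.
move=> u0 v0 w0; set m := Order.meet (u + v) w.
have mw : m <= w by exact: leIr.
have muv : m <= u + v by exact: leIl.
rewrite addrC -lev_subl lexI; apply/andP; split; last first.
  by rewrite lev_subl -[m]addr0; apply: levD => //; rewrite lexI u0.
rewrite lev_subl addrC -lev_subl lexI; apply/andP; split.
  by rewrite lev_subl.
by rewrite lev_subl -[m]addr0; apply: levD.
Qed.

Lemma disj_le u v w : 0 <= u -> 0 <= w -> u <= v ->
  Order.meet v w = 0 -> Order.meet u w = 0.
Proof.
move=> u0 w0 uv vw; apply/le_anti; rewrite lexI u0 w0 !andbT -vw.
by rewrite lexI leIr andbT; exact: le_trans (leIl _ _) uv.
Qed.

Lemma disj_add u v w : 0 <= u -> 0 <= v -> 0 <= w ->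
  Order.meet u w = 0 -> Order.meet v w = 0 -> Order.meet (u + v) w = 0.
Proof.
move=> u0 v0 w0 uw vw; apply/le_anti; rewrite lexI w0 addv_ge0// !andbT.
by apply: le_trans (meet_addv_le u0 v0 w0) _; rewrite uw vw addr0.
Qed.

(** Some natural multiple of [u] dominates [t *: u], and it is a finite sum of elements disjoint
    from [w]. *)
Lemma disj_scale (t : R) u w : 0 <= t -> 0 <= u -> 0 <= w ->
  Order.meet u w = 0 -> Order.meet (t *: u) w = 0.
Proof.
move=> t0 u0 w0 uw.
have : Order.meet (\sum_(i < Num.bound t) u) w = 0 /\ 0 <= \sum_(i < Num.bound t) u.
  elim/big_ind : _ => [|x y [? ?] [? ?]|//]; split => //.
  - exact/meet_l.
  - exact: disj_add.
  - exact: addv_ge0.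
case=> sw _; apply: disj_le sw => //; first exact: scalev_nneg.
rewrite sumr_const card_ord -scaler_nat -subv_ge0 -scalerBl.
by apply: scalev_nneg => //; rewrite subr_ge0 ltW// archi_boundP.
Qed.

(** [u + v - w] is below both [u] and [v], hence below their meet 0. *)
Lemma addv_disj_le u v w : 0 <= u -> 0 <= v -> u <= w -> v <= w ->
  Order.meet u v = 0 -> u + v <= w.
Proof.
move=> u0 v0 uw vw uv; rewrite -[w]add0r -uv -lev_subl lexI.
by rewrite !lev_subl levD// addrC levD.
Qed.

Lemma le_add_disj u v w : 0 <= u -> 0 <= v -> 0 <= w ->
  u <= w + v -> Order.meet u v = 0 -> u <= w.
Proof.
move=> u0 v0 w0 uwv uv.
have : u <= Order.meet (w + v) u by rewrite lexI uwv lexx.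
move/le_trans; apply; apply: le_trans (meet_addv_le w0 v0 u0) _.
by rewrite [Order.meet v u]meetC uv addr0 leIl.
Qed.

Lemma absvD x y : absv (x + y) <= absv x + absv y.
Proof. by apply: absv_le; rewrite ?opprD levD ?le_absv ?leN_absv. Qed.

Lemma absvN x : absv (- x) = absv x.
Proof. by rewrite /absv opprK joinC. Qed.

Lemma absvZ_le (a : R) x : absv (a *: x) <= `|a| *: absv x.
Proof.
by apply: absv_le; rewrite -?scaleNr; apply: scalev_le_norm; rewrite ?normrN.
Qed.

Lemma absv_sub_le u v w : u <= v + w -> v <= u + w -> absv (u - v) <= w.
Proof. by move=> uv vu; apply: absv_le; rewrite ?opprB lev_subl addrC. Qed.

(** * Coordinates along an atom *)

(** Take the largest [l] with [l *: e <= y]. The meet of the remainder with [e] is some [k *: e]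
    with [0 <= k], and [(l + k) *: e <= y] forces [k = 0]. *)
Lemma atom_coordinate_ge0 e y : atom e -> 0 <= y ->
  exists l : R, Order.meet (absv (y - l *: e)) e = 0.
Proof.
move=> [/eqP e_neq0 e0 eatom] y0.
pose A := [set t : R | t *: e <= y].
have A0 : A 0 by rewrite /A/= scale0r.
have supA : has_sup A.
  split; first by exists 0.
  exists (`|y| / `|e|) => t ty; rewrite ler_pdivlMr ?normr_gt0//.
  have [t0|t0] := leP 0 t.
    rewrite -[t]ger0_norm// -normrZ; apply: norm_homo => //.
    exact: scalev_nneg.
  by apply: le_trans (normr_ge0 y); rewrite mulr_le0_ge0// ltW.
(* The supremum is attained because the order is closed in norm. *)
have ley : sup A *: e <= y.
  apply: Defs.le_approx => d d0.
  have c0 : 0 < `|e| + 1 by rewrite ltr_wpDl.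
  have [t At lt] := sup_adherent (divr_gt0 d0 c0) supA.
  exists ((sup A - t) *: e).
    by rewrite scalerBl -lev_subl opprB addrC subrK.
  rewrite normrZ ger0_norm ?subr_ge0; last exact: sup_upper_bound.
  apply: (@le_trans _ _ (d / (`|e| + 1) * `|e|)).
    by rewrite ler_wpM2r// lerBlDr addrC -lerBlDr ltW.
  by rewrite mulrAC ler_pdivrMr// ler_wpM2l ?(ltW d0)// lerDl.
exists (sup A); have z0 : 0 <= y - sup A *: e by rewrite subv_ge0.
rewrite absv_id//; set z := y - _.
have [] := eatom (Order.meet z e); [by rewrite lexI z0|exact: leIr|].
move=> m m0 zm; rewrite zm.
have : m *: e <= z by rewrite -zm leIl.
rewrite -subv_ge0 /z -addrA -opprD -scalerDl subv_ge0.
move/(sup_upper_bound supA); rewrite gerDl => m_le0.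
by rewrite (_ : m = 0) ?scale0r//; apply/le_anti; rewrite m_le0.
Qed.

(** Write [y] as the difference of the positive elements [absv y] and [absv y - y]. *)
Lemma atom_coordinate e y : atom e ->
  exists l : R, Order.meet (absv (y - l *: e)) e = 0.
Proof.
move=> eatom; have e0 : 0 <= e by case: eatom.
have [l Hl] := atom_coordinate_ge0 eatom (absv_ge0 y).
have [k Hk] : exists k : R, Order.meet (absv (absv y - y - k *: e)) e = 0.
  by apply: atom_coordinate_ge0 => //; rewrite subv_ge0 le_absv.
exists (l - k).
have -> : y - (l - k) *: e = (absv y - l *: e) + - (absv y - y - k *: e).
  by rewrite scalerBl !opprB [RHS]addrC !addrA subrK [k *: e + y]addrC.
apply: disj_le (absvD _ _) _; rewrite ?absv_ge0//.
by apply: disj_add; rewrite ?absv_ge0// absvN.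
Qed.

End Disjointness.

(* The common interface of the real case (m = absv, j = id) and of the complex
   case (m = modc, j = cplx_of_real). *)
Record lattice_modulus (R : realType) (X : banachLatticeType R)
    (K : numFieldType) (V : normedModType K) (m : V -> X) (j : X -> V) : Prop := {
  modulus_ge0 : forall v, 0 <= m v;
  modulusD : forall v w, m (v + w) <= m v + m w;
  modulusN : forall v, m (- v) = m v;
  modulusZ : forall (a : K) v, exists2 t : R, 0 <= t & m (a *: v) <= t *: m v;
  modulus_norm : forall v w, m v <= m w -> `|v| <= `|w|;
  embedB : forall x y, j (x - y) = j x - j y;
  modulus_embed : forall x, m (j x) = absv x;
  modulus_coordinate : forall e v, atom e ->
    exists a : K, Order.meet (m (v - a *: j e)) e = 0
}.

(** * Disjointness and stable phase retrieval for a general modulus *)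

Section LatticeModulus.
Variables (R : realType) (X : banachLatticeType R) (K : numFieldType).
Variables (V : normedModType K) (m : V -> X) (j : X -> V).
Hypothesis mj : lattice_modulus m j.
Implicit Types (v w x y : V) (E : set V).

Let m_ge0 := modulus_ge0 mj.
Let mD := modulusD mj.
Let mN := modulusN mj.

Lemma modulus0 : m 0 = 0.
Proof.
have j0 : j 0 = 0 by rewrite -[in LHS](subrr (0 : X)) (embedB mj) subrr.
by rewrite -j0 (modulus_embed mj) absv_id.
Qed.

Lemma disj_linear_subspace (u : X) : 0 <= u ->
  linear_subspace [set v | Order.meet (m v) u = 0].
Proof.
move=> u0; split=> [|a v w /= vu wu]; first by rewrite /= modulus0; exact/meet_l.
have [t t0 at_] := modulusZ mj a v.
apply: (@disj_le _ _ _ (t *: m v + m w)) => //.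
  by apply: le_trans (mD _ _) _; apply: levD; rewrite ?lexx.
by apply: disj_add => //; [exact: scalev_nneg|exact: disj_scale].
Qed.

Lemma modulus_disj v w : Order.meet (m v) (m w) = 0 -> m v <= m (v + w).
Proof.
apply: le_add_disj => //; rewrite -{1}[v](addrK w) -[m w]mN; exact: mD.
Qed.

Lemma norm_disj v w : Order.meet (m v) (m w) = 0 -> `|v| <= `|v + w|.
Proof. by move/modulus_disj/(modulus_norm mj). Qed.

(** [m v] and [m w] both lie below [m (v - w)]; being disjoint, so does their sum, which dominates
    [m (v + w)]. *)
Lemma modulus_disjDB v w : Order.meet (m v) (m w) = 0 -> m (v + w) = m (v - w).
Proof.
have le v' w' : Order.meet (m v') (m w') = 0 -> m (v' + w') <= m (v' - w').
  move=> vw; apply: le_trans (mD _ _) _; apply: addv_disj_le => //.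
    by apply: modulus_disj; rewrite mN.
  rewrite -[m (v' - w')]mN opprB; apply: modulus_disj.
  by rewrite mN meetC.
move=> vw; apply/le_anti/andP; split; first exact: le.
by rewrite -{2}[w]opprK; apply: le; rewrite mN.
Qed.

Lemma modulus_lipschitz v w : `|j (m v) - j (m w)| <= `|v - w|.
Proof.
rewrite -(embedB mj); apply: (modulus_norm mj); rewrite (modulus_embed mj).
apply: absv_sub_le; rewrite addrC.
  by rewrite -{1}[v](subrK w).
by rewrite -[m (v - w)]mN opprB -{1}[w](subrK v).
Qed.

Lemma norm_almost_disj (C l : K) x y w : 1 <= C -> `|l| = 1 -> `|y| = `|x| ->
  Order.meet (m w) (m y) = 0 ->
  `|x + y - l *: (x - y)| <= C * `|j (m (x + y)) - j (m (x - y))| ->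
  `|x| <= (3%:R + 2%:R * C) * `|x - w|.
Proof.
move=> C1 l1 yx wy spr; set d := `|x - w|.
set N := `|(1 - l) *: w + (1 + l) *: y|.
(* The moduli of [x + y] and [x - y] are each within [d] of the common modulus of [w + y] and
   [w - y]. *)
have upper : `|x + y - l *: (x - y)| <= C * (2%:R * d).
  apply: le_trans spr _; rewrite ler_wpM2l ?(le_trans ler01)//.
  have wyE := modulus_disjDB wy.
  rewrite -[j (m (x + y))](subrK (j (m (w + y)))) {2}wyE -addrA.
  apply: le_trans (ler_normD _ _) _; rewrite mulr_natl mulr2n lerD//.
    by apply: le_trans (modulus_lipschitz _ _) _; rewrite opprD addrACA subrr addr0.
  apply: le_trans (modulus_lipschitz _ _) _.
  by rewrite opprB addrA subrK distrC.
have l2 : `|1 - l| <= 2%:R.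
  by apply: le_trans (ler_normB _ _) _; rewrite l1 normr1.
(* Replacing [x] by [w] in [(1 - l) *: x + (1 + l) *: y] costs at most [2 d]. *)
have lower : N <= `|x + y - l *: (x - y)| + 2%:R * d.
  rewrite /N; have -> : (1 - l) *: w + (1 + l) *: y =
      (x + y - l *: (x - y)) - (1 - l) *: (x - w).
    have -> : x + y - l *: (x - y) = (1 - l) *: x + (1 + l) *: y.
      rewrite scalerBl scalerDl !scale1r scalerBr opprB.
      by rewrite [l *: y - _]addrC addrACA.
    by rewrite scalerBr opprB [RHS]addrC addrA subrK.
  apply: le_trans (ler_normB _ _) _; rewrite lerD2l normrZ ler_wpM2r//.
have ab (a b : K) : Order.meet (m (a *: w)) (m (b *: y)) = 0.
  have := disj_linear_subspace (m_ge0 y) => /(linear_subspaceZ a)/(_ wy) /= wy'.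
  rewrite meetC; apply: (linear_subspaceZ b (disj_linear_subspace (m_ge0 (a *: w)))).
  by rewrite /= meetC.
have Nw : `|1 - l| * `|w| <= N.
  by rewrite -normrZ; apply: norm_disj; exact: ab.
have Ny : `|1 + l| * `|x| <= N.
  by rewrite -yx -normrZ /N [X in _ <= `|X|]addrC; apply: norm_disj; rewrite meetC ab.
have xw : `|x| <= `|w| + d by rewrite -{1}[x](subrK w) addrC ler_normD.
have l3 : 2%:R <= `|1 - l| + `|1 + l|.
  apply: le_trans (ler_normD _ _); rewrite addrACA addNr addr0.
  by rewrite ger0_norm.
have d0 : 0 <= d by exact: normr_ge0.
have x0 := normr_ge0 x.
(* Each disjoint component has norm at most [N]. With [N <= 2 C d + 2 d], the extra [d] produces the
   constant [3 + 2 C]. *)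
have N2 : 2%:R * `|x| <= 2%:R * (N + d).
  apply: le_trans (ler_wpM2r x0 l3) _; rewrite mulrDl.
  apply: (@le_trans _ _ (`|1 - l| * (`|w| + d) + N)).
    by rewrite lerD// ler_wpM2l.
  rewrite mulrDr addrAC mulrDr; apply: lerD; last by rewrite ler_wpM2r.
  by rewrite [leRHS]mulr_natl mulr2n lerD.
rewrite ler_pM2l ?ltr0n// in N2; apply: le_trans N2 _.
apply: le_trans (lerD lower (lexx d)) _.
apply: le_trans (lerD (lerD upper (lexx _)) (lexx d)) _.
by rewrite le_eqVlt; apply/orP; left; apply/eqP; ring.
Qed.

Lemma SPR_infinite_codimension E :
  linear_subspace E -> ~ finite_dimensional E -> SPR (fun v => j (m v)) E ->
  ~ finite_codimension (closure (lin_span (j @` @atom R X))).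
Proof.
move=> lE Einf [C C1 spr] [s cods].
(* The closure of the span in metric form, for which linearity is a norm estimate. *)
pose F : set V := [set v | forall d : K, 0 < d ->
  exists2 w, lin_span (j @` @atom R X) w & `|v - w| < d].
have lF : linear_subspace F.
  split=> [d d0|a v w Fv Fw d d0].
    by exists 0; [exact: (lin_span_linear _).1|rewrite subrr normr0].
  have c0 : 0 < `|a| + 1 by rewrite ltr_wpDl.
  have [v' sv' vv'] := Fv _ (divr_gt0 (divr_gt0 d0 (ltr0n K 2)) c0).
  have [w' sw' ww'] := Fw _ (divr_gt0 d0 (ltr0n K 2)).
  exists (a *: v' + w'); first exact: (lin_span_linear _).2.
  rewrite opprD addrACA -scalerBr; apply: le_lt_trans (ler_normD _ _) _.
  rewrite [ltRHS]splitr; apply: ler_ltD => //; rewrite normrZ.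
  apply: le_trans (_ : (`|a| + 1) * `|v - v'| <= _).
    by rewrite ler_wpM2r// lerDl.
  by rewrite mulrC -ler_pdivlMr// ltW.
have codF : finite_codimension F.
  exists s => v; have [w sw cw] := cods v; exists w => // d d0.
  have [u [su]] := cw _ (nbhsx_ballx (v - w) _ d0).
  by rewrite -ball_normE /= => vu; exists u.
have [x [Ex /eqP x_neq0 Fx]] :=
  infinite_dimensional_finite_codimension lE Einf lF codF.
have c0 : 0 < 3%:R + 2%:R * C.
  by rewrite ltr_wpDr ?ltr0n// mulr_ge0// (le_trans ler01).
(* This strict tolerance is what [norm_almost_disj] contradicts. *)
have [|w [n [a [u [au wE]]]] xw] := Fx (`|x| / (3%:R + 2%:R * C)).
  by rewrite divr_gt0// normr_gt0.
have /choice[e ue] : forall i, exists e, atom e /\ j e = u i.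
  by move=> i; have [e ? ?] := au i; exists e.
have e0 i : 0 <= e i by have [[]] := ue i.
(* The row [r] lists coordinates of [v] along the atoms; [r = 0] means that [v] is disjoint from all
   of them. *)
have [|v||b v v' r r' vr vr' i|y [Ey /eqP y_neq0 ye]] := @infinite_dimensional_kernel _ _ E n
  (fun v r => forall i, Order.meet (m (v - r 0 i *: j (e i))) (e i) = 0) lE.
- exact: Einf.
- have /choice[r vr] : forall i, exists a : K,
      Order.meet (m (v - a *: j (e i))) (e i) = 0.
    by move=> i; apply: (modulus_coordinate mj); have [] := ue i.
  by exists (\row_i r i) => i; rewrite mxE.
- move=> i; rewrite mxE scale0r subr0 modulus0; exact/meet_l.
- rewrite !mxE scalerDl -scalerA opprD addrACA.
  rewrite -scalerBr; exact: (disj_linear_subspace (e0 i)).2.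
pose y' := (`|x| / `|y|) *: y.
have Ey' : E y' by exact: linear_subspaceZ.
have ny' : `|y'| = `|x|.
  by rewrite normrZ normrM normfV !normr_id divfK// normr_eq0.
have wy : Order.meet (m w) (m y') = 0.
  rewrite wE; have ly := disj_linear_subspace (m_ge0 y').
  apply: (linear_subspace_sum _ ly) => i /=; have [_ <-] := ue i; rewrite (modulus_embed mj) absv_id// meetC.
  apply: (linear_subspaceZ _ (disj_linear_subspace (e0 i))).
  by have /= := ye i; rewrite mxE scale0r subr0.
have [l l1 Hl] := spr _ _ (linear_subspaceD lE Ex Ey') (linear_subspaceB lE Ex Ey').
have := norm_almost_disj C1 l1 ny' wy Hl.
rewrite -ler_pdivrMl// mulrC => /le_lt_trans/(_ xw).
by rewrite ltxx.
Qed.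

End LatticeModulus.

(** * The real and the complex modulus *)

Lemma absv_lattice_modulus (R : realType) (X : banachLatticeType R) :
  @lattice_modulus R X R X (@absv R X) id.
Proof.
split=> //.
- exact: absv_ge0.
- exact: absvD.
- exact: absvN.
- by move=> a v; exists `|a| => //; exact: absvZ_le.
- exact: norm_absv_homo.
- by move=> e v; exact: atom_coordinate.
Qed.

Section Modc.
Variables (R : realType) (X : banachLatticeType R).
Notation XC := (complexification X).
Implicit Types (z w : XC).

Lemma modcD z w : modc (z + w) <= modc z + modc w.
Proof.
apply: modc_lub => t /=; rewrite !scalerDr addrACA.
by apply: levD; exact: modc_ub.
Qed.

(** Negation shifts the angle by [pi], which permutes the family whose supremum is the modulus. *)
Lemma modcN z : modc (- z) = modc z.
Proof.
have le w : modc (- w) <= modc w.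
  apply: modc_lub => t; have := modc_ub w (t + pi).
  by rewrite cosDpi sinDpi /= !scaleNr !scalerN.
by apply/le_anti/andP; split => //; rewrite -{1}[z]opprK.
Qed.

Lemma absv_fst_le z : absv z.1 <= modc z.
Proof. by have [? ? _ _] := modc_pm z; exact: absv_le. Qed.

Lemma absv_snd_le z : absv z.2 <= modc z.
Proof. by have [_ _ ? ?] := modc_pm z; exact: absv_le. Qed.

Lemma modc_le z : modc z <= absv z.1 + absv z.2.
Proof.
apply: modc_lub => t; rewrite -[absv z.1]scale1r -[absv z.2]scale1r.
by apply: levD; apply: scalev_le_norm; rewrite ler_norml ?cos_geN1 ?cos_le1 ?sin_geN1 ?sin_le1.
Qed.

(** A crude factor is enough: [modulusZ] asks only for some real bound. *)
Lemma modcZ_le (a : R[i]) z :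
  modc (a *: z) <=
    ((`|complex.Re a| + `|complex.Im a|) *+ 2) *: modc z.
Proof.
apply: le_trans (modc_le _) _; rewrite mulr2n scalerDl.
have scale_le (c : R) (x : X) : absv x <= modc z -> absv (c *: x) <= `|c| *: modc z.
  by move=> xz; apply: le_trans (absvZ_le _ _) _; exact: scalev_homo.
apply: levD; apply: le_trans (absvD _ _) _; rewrite ?absvN scalerDl;
  by apply: levD; apply: scale_le; rewrite ?absv_fst_le ?absv_snd_le.
Qed.

Lemma modc_norm z w : modc z <= modc w -> `|z| <= `|w|.
Proof.
move=> zw; change (normXC z <= normXC w); rewrite /normXC lecR.
by apply: norm_homo => //; exact: modc_ge0.
Qed.

Lemma modc_lattice_modulus :
  @lattice_modulus R X R[i] XC (@modc R X) (@cplx_of_real R X).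
Proof.
split.
- exact: modc_ge0.
- exact: modcD.
- exact: modcN.
- move=> a z; eexists; last exact: modcZ_le.
  by rewrite mulrn_wge0// addr_ge0.
- exact: modc_norm.
- by move=> x y; congr pair; rewrite /= subr0.
- exact: modc_real.
- move=> e z eatom; have e0 : 0 <= e by case: eatom.
  have [a za] := atom_coordinate z.1 eatom.
  have [b zb] := atom_coordinate z.2 eatom.
  (* The real and imaginary parts of the remainder are each disjoint from [e], and their absolute
     values sum to a bound of its modulus. *)
  exists (a +i* b)%C; apply: (disj_le (modc_ge0 _) e0 (modc_le _)).
  by apply: disj_add; rewrite ?absv_ge0//= scaler0 ?subr0 ?add0r.
Qed.

End Modc.

Theorem proposition2p3 (R : realType) (X : banachLatticeType R) :
  ((exists E : set X,
      [/\ linear_subspace E, ~ finite_dimensional E & SPR (@absv R X) E]) ->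
   ~ finite_codimension (closure (lin_span (@atom R X))))
  /\
  ((exists E : set (complexification X),
      [/\ linear_subspace E, ~ finite_dimensional E & SPR (@absc R X) E]) ->
   ~ finite_codimension (closure (lin_span (@atomc R X)))).
Proof.
split=> -[E [lE Einf sprE]].
  rewrite -[@atom R X]image_id.
  exact: (SPR_infinite_codimension (absv_lattice_modulus X) lE Einf sprE).
exact: (SPR_infinite_codimension (modc_lattice_modulus X) lE Einf sprE).
Qed.
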